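(* Let $Z=(Z_t)_{t\ge0}$ be a homogeneous continuous-time Markov chain on $S=\{1,\dots,N\}$ with true generator $Q^\star=(q^\star_{ik})$, where $q^\star_{ik}>0$ for all $i\ne k$. Suppose that $Q^\star$ is irreducible, that $Z$ admits a unique invariant probability measure $\pi=(\pi_1,\dots,\pi_N)$ on $S$, and that $Z$ is strictly stationary. Suppose $Z$ is observed at $t_j=jh$, $j=0,\dots,n$, where $h=h_n>0$ satisfies $h\to0$, $nh\to\infty$ and $nh^2\to0$ as $n\to\infty$. Let $K_{ik}(n)=\sum_{j=1}^nI_{\{Z_{t_{j-1}}=i\}}I_{\{Z_{t_j}=k\}}$ and define the quasi-maximum likelihood estimator $\hat Q_n=(\hat q^{(n)}_{ik})$ by $$\hat q^{(n)}_{ik}=\frac{K_{ik}(n)}{h\sum_{l=1}^NK_{il}(n)}\quad(i\ne k),\qquad \hat q^{(n)}_{ii}=-\sum_{l\ne i}\hat q^{(n)}_{il}.$$ Then $\hat q^{(n)}_{ik}\to q^\star_{ik}$ in probability as $n\to\infty$, for all $i,k\in S$.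
   Context: The generator $Q=(q_{ij})$ is characterized by $\mathbb P(Z_{t+h}=j\mid Z_t=i)=I_{\{i=j\}}+q_{ij}h+o(h)$ as $h\to0$, with $q_{ii}=-\sum_{j\ne i}q_{ij}$. $Q$ is called irreducible if the system $\nu Q=0$, $\sum_{i=1}^N\nu_i=1$ has a unique solution $\nu=(\nu_1,\dots,\nu_N)$. $I_A$ denotes the indicator of $A$. The estimator is the explicit maximizer, over the closure of the parameter set $\{(q_{ij})_{i\ne j}: q_{ij}>0\}$, of the quasi-log-likelihood $\mathbb M_n=\sum_{i=1}^N\sum_{k=1}^NK_{ik}(n)\log F(q_{ik})$, where $F(q_{ik})=\big(1-\sum_{l\ne i}q_{il}h\big)I_{\{i=k\}}+q_{ik}h\,I_{\{i\ne k\}}$. On the event that $\sum_lK_{il}(n)=0$ the value of $\hat q^{(n)}_{ik}$ may be set arbitrarily (this event has probability tending to zero). *)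

(* Defs.v *)
From HB Require Import structures.
From mathcomp Require Import all_boot all_order all_algebra.
From mathcomp Require Import all_classical all_reals all_analysis.

Set Implicit Arguments.
Unset Strict Implicit.
Unset Printing Implicit Defensive.

Import Order.TTheory GRing.Theory Num.Theory.
Import numFieldNormedType.Exports.

Local Open Scope classical_set_scope.
Local Open Scope ring_scope.

(* The state space {1, ..., N} is 'I_N. A process indexed by [0, +oo[ is a
   function on R of which only the values at nonnegative times are used. *)

Definition cond_prob (R : realType) (d : measure_display)
    (T : measurableType d) (P : probability T R) (A B : set T) : R :=
  fine (P (A `&` B)) / fine (P B).

Definition is_process (R : realType) (d : measure_display)
    (T : measurableType d) (N : nat) (Z : R -> T -> 'I_N) : Prop :=
  forall t i, 0 <= t -> measurable [set w | Z t w = i].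

(* The cylinder event "Z_u = a for every pair (u, a) in s". *)
Definition path_event (R : realType) (T : Type) (N : nat)
    (Z : R -> T -> 'I_N) (s : seq (R * 'I_N)) : set T :=
  [set w | forall x, x \in s -> Z x.1 w = x.2].

Definition transition_function (R : realType) (N : nat)
    (p : R -> 'M[R]_N) : Prop :=
  [/\ forall t i j, 0 <= t -> 0 <= p t i j,
      forall t i, 0 <= t -> \sum_(j < N) p t i j = 1,
      p 0 = 1%:M
    & forall s t, 0 <= s -> 0 <= t -> p (s + t) = p s *m p t].

(* Markov property and time homogeneity at once: given Z_t = i and any
   finite-dimensional event s of the past of t, the law of Z_(t + u) is the
   i-th row of p u; neither s nor t appears on the right-hand side. *)
Definition homogeneous_markov_chain (R : realType) (d : measure_display)
    (T : measurableType d) (P : probability T R) (N : nat)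
    (Z : R -> T -> 'I_N) (p : R -> 'M[R]_N) : Prop :=
  [/\ is_process Z, transition_function p
    & forall (s : seq (R * 'I_N)) (t u : R) (i j : 'I_N),
        0 <= t -> 0 <= u ->
        (forall x, x \in s -> 0 <= x.1 <= t) ->
        (0 < P ([set w | Z t w = i] `&` path_event Z s))%E ->
        cond_prob P [set w | Z (t + u) w = j]
          ([set w | Z t w = i] `&` path_event Z s) = p u i j].

(* Here p h i j is P(Z_(t + h) = j | Z_t = i). *)
Definition is_generator (R : realType) (N : nat)
    (p : R -> 'M[R]_N) (Q : 'M[R]_N) : Prop :=
  (forall i j : 'I_N,
     (fun h : R => p h i j)
       = (fun h : R => (i == j)%:R + Q i j * h) +o_ (0^'+) (fun h : R => h))
  /\ (forall i : 'I_N, Q i i = - \sum_(j < N | j != i) Q i j).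

Definition irreducible_generator (R : realType) (N : nat)
    (Q : 'M[R]_N) : Prop :=
  exists! nu : 'rV[R]_N, nu *m Q = 0 /\ \sum_(i < N) nu 0 i = 1.

Definition invariant_probability (R : realType) (N : nat)
    (p : R -> 'M[R]_N) (nu : 'rV[R]_N) : Prop :=
  [/\ forall i, 0 <= nu 0 i, \sum_(i < N) nu 0 i = 1
    & forall t, 0 <= t -> nu *m p t = nu].

(* Equality of all finite-dimensional distributions under time shifts; the
   state space being finite, it suffices to compare point masses. *)
Definition strictly_stationary (R : realType) (d : measure_display)
    (T : measurableType d) (P : probability T R) (N : nat)
    (Z : R -> T -> 'I_N) : Prop :=
  forall (s : seq (R * 'I_N)) (u : R), 0 <= u ->
    (forall x, x \in s -> 0 <= x.1) ->
    P (path_event Z [seq (x.1 + u, x.2) | x <- s]) = P (path_event Z s).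

Definition transition_count (R : realType) (T : Type) (N : nat)
    (Z : R -> T -> 'I_N) (h : nat -> R) (n : nat) (i k : 'I_N) (w : T) : nat :=
  (\sum_(1 <= j < n.+1)
     (Z (j.-1%:R * h n)%R w == i) * (Z (j%:R * h n)%R w == k))%N.

(* The row i of the estimator is prescribed only where state i is visited
   before t_n; elsewhere its off-diagonal values are arbitrary (but
   measurable, being random variables). *)
Definition is_qmle (R : realType) (d : measure_display)
    (T : measurableType d) (P : probability T R) (N : nat)
    (Z : R -> T -> 'I_N) (h : nat -> R)
    (qhat : nat -> 'I_N -> 'I_N -> {RV P >-> R}) : Prop :=
  (forall (n : nat) (i k : 'I_N) (w : T), i != k ->
     (\sum_(l < N) transition_count Z h n i l w)%N != 0%N ->
     qhat n i k w = (transition_count Z h n i k w)%:R /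
       (h n * (\sum_(l < N) transition_count Z h n i l w)%N%:R))
  /\ (forall (n : nat) (i : 'I_N) (w : T),
     qhat n i i w = - \sum_(l < N | l != i) qhat n i l w).

Definition cvg_in_probability (R : realType) (d : measure_display)
    (T : measurableType d) (P : probability T R)
    (X : nat -> {RV P >-> R}) (c : R) : Prop :=
  forall e : R, 0 < e ->
    P [set w | e < `|X n w - c|] @[n --> \oo] --> 0%E.

(* Main.v *)
Require Import Defs.
From HB Require Import structures.
From mathcomp Require Import all_boot all_order all_algebra.
From mathcomp Require Import all_classical all_reals all_analysis.
From mathcomp Require Import measurable_realfun ring lra.
Import Order.TTheory GRing.Theory Num.Theory.
Import numFieldNormedType.Exports.
Local Open Scope classical_set_scope.
Local Open Scope ring_scope.
Set Implicit Arguments.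
Unset Strict Implicit.

(** Write K_ik for the number of observed transitions from i to k, and
    K_i = \sum_l K_il for the number of visits to i before time n h.  The
    estimator of q_ik, for i <> k, is K_ik / (h K_i), and K_ik should be close
    to p_ik(h) K_i with p_ik(h) = q_ik h + o(h).  The proof has a stochastic
    half and a pathwise half; the diagonal follows from the row sums
    ([qmle_row_close]).

    Stochastic half.  The compensated count M_ik = K_ik - p_ik(h) K_i is a sum
    of martingale differences: each visit to i contributes a centred Bernoulli
    variable of variance at most p_ik(h).  Hence its second moment is at most
    n p_ik(h) = O(n h), and Chebyshev's inequality gives
    P(|M_ik| > a n h) = O(1 / (a^2 n h)), which tends to 0
    ([transition_excess_tail]).  The Markov property is only available on
    cylinder events, so the tail is bounded by descending induction on time,
    over the cylinders of the past ([transition_excess_tail_after]).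

    Pathwise half.  Suppose that |M_lk| <= a n h for all l <> k.  Dividing by
    h K_i gives the claim as soon as K_i is at least a fixed proportion of n
    ([empirical_rate_close]).  This proportion comes from conservation of flow
    ([visits_ge]): the numbers of entries into i and of exits from i differ by
    at most 1; if K_i were small, the exits, about K_i \sum_(k <> i) p_ik(h),
    would be few, while the entries, about
    \sum_(l <> i) p_li(h) K_l >= c h (n - K_i), would be many, because all
    off-diagonal rates are positive. *)

(** * Cylinder events of a Markov chain *)

Lemma measurable_norm_gt {R : realType} {d : measure_display}
    {T : measurableType d} (f : T -> R) (a : R) :
  measurable_fun setT f -> measurable [set w | a < `|f w|].
Proof.
move=> mf; have mnf : measurable_fun setT (fun w => `|f w|).
  exact: measurableT_comp.
have := mnf measurableT _ (measurable_itv `]a, +oo[); rewrite setTI.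
by congr (measurable _); apply/seteqP; split=> w /=; rewrite in_itv /= andbT.
Qed.

Section Cylinders.
Context (R : realType) (d : measure_display) (T : measurableType d)
  (P : probability T R) (N : nat) (Z : R -> T -> 'I_N).

Lemma measurable_path_event (s : seq (R * 'I_N)) :
  is_process Z -> (forall x, x \in s -> 0 <= x.1) ->
  measurable (path_event Z s).
Proof.
move=> mZ; elim: s => [|x s IH] s0.
  rewrite (_ : path_event _ _ = setT) //; apply/seteqP.
  by split=> // w _ y; rewrite in_nil.
rewrite (_ : path_event _ _ = [set w | Z x.1 w = x.2] `&` path_event Z s).
  apply: measurableI; first by apply: mZ; apply: s0; rewrite mem_head.
  by apply: IH => y ys; apply: s0; rewrite inE ys orbT.
apply/seteqP; split=> [w Hw|w [Hx Hs] y] /=.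
  by split=> [|y ys]; apply: Hw; rewrite inE ?eqxx ?ys ?orbT.
by rewrite inE => /predU1P[->|/Hs].
Qed.

Lemma total_probability (t : R) (A : set T) :
  is_process Z -> 0 <= t -> measurable A ->
  fine (P A) = \sum_(k < N) fine (P ([set w | Z t w = k] `&` A)).
Proof.
move=> mZ t0 mA; have mk k : measurable ([set w | Z t w = k] `&` A).
  by apply: measurableI => //; exact: mZ.
rewrite sum_fine; last by move=> k _; rewrite fin_num_measure.
rewrite -(measure_bigsetU_ord P xpredT mk); last first.
  by move=> i j _ _ [w [[<- _] [<- _]]].
congr (fine (P _)); apply/seteqP; split=> w.
  by move=> Aw; rewrite (bigD1 (Z t w)) //; left.
by elim/big_ind: _ => // [X Y IX IY []//|k _ []].
Qed.

(** Multiplied out, the Markov property extends to cylinders of probability 0,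
    where both sides vanish. *)
Lemma markov_step (p : R -> 'M[R]_N) (s : seq (R * 'I_N)) (t u : R)
    (i k : 'I_N) :
  homogeneous_markov_chain P Z p -> 0 <= t -> 0 <= u ->
  (forall x, x \in s -> 0 <= x.1 <= t) ->
  fine (P ([set w | Z (t + u) w = k] `&`
           ([set w | Z t w = i] `&` path_event Z s))) =
  p u i k * fine (P ([set w | Z t w = i] `&` path_event Z s)).
Proof.
move=> [mZ _ mk] t0 u0 s0; set B := (X in _ `&` X).
have mB : measurable B.
  apply: measurableI; first exact: mZ.
  by apply: measurable_path_event => // x /s0 /andP[].
have [PB|] := ltP 0%E (P B).
  rewrite -(mk s t u i k) // /cond_prob -/B divfK //.
  by rewrite gt_eqF // fine_gt0 // PB ltey_eq fin_num_measure.
move=> PB; have B0 : P B = 0%E by apply/eqP; rewrite eq_le PB measure_ge0.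
rewrite B0 mulr0; suff -> : P ([set w | Z (t + u) w = k] `&` B) = 0%E by [].
apply/eqP; rewrite eq_le measure_ge0 andbT -B0 le_measure ?inE //.
by apply: measurableI => //; apply: mZ; rewrite addr_ge0.
Qed.

End Cylinders.

(** * Second moment of the compensated transition counts *)

(** The compensated count M_ik of the transitions from [i] to [k], where [c]
    stands for the transition probability; see [transition_excess_count]. *)
Definition transition_excess {R : realType} {T : Type} {N : nat}
    (Z : R -> T -> 'I_N) (h c : R) (i k : 'I_N) (n : nat) (w : T) : R :=
  \sum_(j < n) (Z (j%:R * h) w == i)%:R * ((Z (j.+1%:R * h) w == k)%:R - c).

Section CompensatedCounts.
Context (R : realType) (d : measure_display) (T : measurableType d)
  (P : probability T R) (N : nat) (Z : R -> T -> 'I_N).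

Lemma measurable_transition_excess (h c : R) (i k : 'I_N) (n : nat) :
  is_process Z -> 0 <= h ->
  measurable_fun setT (transition_excess Z h c i k n).
Proof.
move=> mZ h0; have mI (m : nat) l :
    measurable_fun setT (fun w => (Z (m%:R * h) w == l)%:R : R).
  rewrite (_ : (fun w => _) = \1_[set w | Z (m%:R * h) w = l]).
    by apply: measurable_indic; apply: mZ; rewrite mulr_ge0.
  by apply/funext => w; rewrite indicE; congr (nat_of_bool _)%:R;
     apply/eqP/idP; rewrite inE.
apply: measurable_sum => j; apply: measurable_funM; first exact: mI.
by apply: measurable_funB; [exact: mI|exact: measurable_cst].
Qed.

Lemma measurable_transition_excess_tail (h c a : R) (i k : 'I_N) (n : nat) :
  is_process Z -> 0 <= h ->
  measurable [set w | a < `|transition_excess Z h c i k n w|].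
Proof.
by move=> mZ h0; apply: measurable_norm_gt; exact: measurable_transition_excess.
Qed.

(** Conditional Chebyshev inequality.  On a cylinder of the past of step [j]
    that fixes the compensated count at [x], the conditional mean square of
    the count [r] steps later is at most [x ^+ 2 + r * p h i k].  The induction
    on [r] splits the event by the next state [m] and applies the Markov
    property once: the increment [D m] has conditional mean 0 and conditional
    variance at most [p h i k]. *)
Lemma transition_excess_tail_after (p : R -> 'M[R]_N) (h a : R) (i k l : 'I_N)
    (r j : nat) (s : seq (R * 'I_N)) (x : R) :
  homogeneous_markov_chain P Z p -> 0 < h -> 0 < a ->
  (forall y, y \in s -> 0 <= y.1 <= j%:R * h) ->
  let A := [set w | Z (j%:R * h) w = l] `&` path_event Z s in
  (forall w, A w -> transition_excess Z h (p h i k) i k j w = x) ->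
  fine (P ([set w | a < `|transition_excess Z h (p h i k) i k (j + r) w|]
           `&` A))
  <= fine (P A) * ((x ^+ 2 + r%:R * p h i k) / a ^+ 2).
Proof.
move=> Zm h0 a0; have [mZ [p0 p1 _ _] _] := Zm.
set M := transition_excess Z _ _ _ _.
have mM n : measurable [set w | a < `|M n w|].
  by apply: measurable_transition_excess_tail => //; exact: ltW.
elim: r j l s x => [|r IH] j l s x s0 A MA.
  have mA : measurable A.
    apply: measurableI; first by apply: mZ; rewrite mulr_ge0 // ltW.
    by apply: measurable_path_event => // y /s0 /andP[].
  rewrite addn0 mul0r addr0; have [ax|ax] := ltP a `|x|.
    apply: (@le_trans _ _ (fine (P A))).
      rewrite fine_le ?fin_num_measure //; first exact: measurableI.
      by rewrite le_measure ?inE //; first exact: measurableI.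
    rewrite ler_peMr ?fine_ge0 // lter_pdivlMr ?exprn_gt0 // mul1r.
    by rewrite -(real_normK (num_real x)) ler_sqr ?nnegrE // ltW.
  rewrite (_ : _ `&` A = set0) ?measure0 /=.
    by rewrite mulr_ge0 ?fine_ge0 // divr_ge0 // sqr_ge0.
  by apply/seteqP; split=> // w [/= aM /MA Mx]; rewrite Mx ltNge ax in aM.
have jh0 : 0 <= j%:R * h by rewrite mulr_ge0 // ltW.
have mA : measurable A.
  apply: measurableI; first exact: mZ.
  by apply: measurable_path_event => // y /s0 /andP[].
have jS : j.+1%:R * h = j%:R * h + h by rewrite -natr1 mulrDl mul1r.
have jSh0 : 0 <= j.+1%:R * h by rewrite mulr_ge0 // ltW.
rewrite (total_probability P mZ jSh0); last exact: measurableI.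
(* Seen from step [j.+1], the present state [l] belongs to the past. *)
pose s' := (j%:R * h, l) :: s.
have As' : A = path_event Z s'.
  apply/seteqP; split=> [w [Hl Hs] y|w Hw].
    by rewrite inE => /predU1P[->|/Hs].
  split=> [|y ys]; first by apply: (Hw (j%:R * h, l)); rewrite mem_head.
  by apply: Hw; rewrite inE ys orbT.
have s'0 y : y \in s' -> 0 <= y.1 <= j.+1%:R * h.
  rewrite inE jS => /predU1P[-> /=|/s0 /andP[-> /= le_y]].
    by rewrite jh0 lerDl ltW.
  by rewrite (le_trans le_y) // lerDl ltW.
pose D (m : 'I_N) : R := (l == i)%:R * ((m == k)%:R - p h i k).
have step m : fine (P ([set w | Z (j.+1%:R * h) w = m] `&`
      ([set w | a < `|M (j + r.+1)%N w|] `&` A))) <=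
    p h l m * fine (P A) * (((x + D m) ^+ 2 + r%:R * p h i k) / a ^+ 2).
  rewrite setIA (setIC [set w | Z _ w = m]) -setIA addnS -addSn.
  have := IH j.+1 m s' (x + D m) s'0; rewrite -As'.
  rewrite [X in _ * fine (P X)](_ : A =
    [set w | Z (j%:R * h) w = l] `&` path_event Z s) //.
  rewrite -(markov_step l m Zm jh0 (ltW h0) s0) -jS.
  apply=> w [/= Zm' Aw]; have [Zl _] := Aw.
  have := MA w Aw.
  by rewrite /M /transition_excess big_ord_recr /= Zl Zm' => ->.
apply: (le_trans (ler_sum _ (fun m _ => step m))).
have pl : \sum_(m < N) p h l m = 1 by rewrite p1 // ltW.
have pD : \sum_(m < N) p h l m * D m = 0.
  rewrite /D; case: eqP => [->|_]; last first.
    by rewrite big1 // => m _; rewrite mul0r mulr0.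
  under eq_bigr do rewrite mul1r mulrBr.
  rewrite sumrB -mulr_suml (p1 h i (ltW h0)) mul1r (bigD1 k) //= eqxx mulr1.
  rewrite big1 ?addr0 ?subrr // => m /negPf ->; exact: mulr0.
(* In state [i] the increment is a centred Bernoulli variable; with
   q = [p h i k] its variance is q - q^2. *)
have pD2 : \sum_(m < N) p h l m * D m ^+ 2 <= p h i k.
  rewrite /D; case: eqP => [->|_]; last first.
    by rewrite big1 ?p0 ?ltW // => m _; rewrite mul0r expr0n mulr0.
  rewrite (eq_bigr (fun m => p h i m * (m == k)%:R * (1 - 2 * p h i k)
      + p h i m * p h i k ^+ 2)); last first.
    by move=> m _; case: (m == k) => /=; ring.
  rewrite big_split /= -!mulr_suml (p1 h i (ltW h0)) (bigD1 k) //= eqxx mulr1.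
  rewrite big1 ?addr0; last by move=> m /negPf ->; exact: mulr0.
  have := sqr_ge0 (p h i k); nra.
rewrite (eq_bigr (fun m => fine (P A) / a ^+ 2 *
    (p h l m * (x ^+ 2 + r%:R * p h i k) + 2 * x * (p h l m * D m) +
     p h l m * D m ^+ 2))); last first.
  by move=> m _; ring.
rewrite -mulr_sumr !big_split /= -mulr_suml -mulr_sumr pl pD mul1r mulr0 addr0.
rewrite [leRHS]mulrA [leRHS]mulrAC ler_wpM2l ?divr_ge0 ?fine_ge0 ?sqr_ge0 //.
by rewrite -natr1 mulrDl mul1r addrA lerD2l.
Qed.

Lemma transition_excess_tail (p : R -> 'M[R]_N) (h a : R) (i k : 'I_N)
    (n : nat) :
  homogeneous_markov_chain P Z p -> 0 < h -> 0 < a ->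
  fine (P [set w | a < `|transition_excess Z h (p h i k) i k n w|])
  <= n%:R * p h i k / a ^+ 2.
Proof.
move=> Zm h0 a0; have [mZ _ _] := Zm.
have mE : measurable [set w | a < `|transition_excess Z h (p h i k) i k n w|].
  by apply: measurable_transition_excess_tail => //; exact: ltW.
rewrite (total_probability P mZ (lexx 0) mE).
have step l : fine (P ([set w | Z 0 w = l] `&`
      [set w | a < `|transition_excess Z h (p h i k) i k n w|])) <=
    fine (P ([set w | Z 0 w = l] `&` setT)) * (n%:R * p h i k / a ^+ 2).
  have e0 : path_event Z [::] = setT.
    by apply/seteqP; split=> // w _ y; rewrite in_nil.
  have := @transition_excess_tail_after p h a i k l n 0 [::] 0 Zm h0 a0.
  rewrite /= e0 !setIT mul0r add0n expr0n add0r setIC; apply=> // w _.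
  by rewrite /transition_excess big_ord0.
apply: (le_trans (ler_sum _ (fun l _ => step l))).
rewrite -mulr_suml -(total_probability P mZ (lexx 0)) //.
by rewrite probability_setT mul1r.
Qed.

End CompensatedCounts.

(** * Bookkeeping of transition counts *)

Section TransitionCounts.
Context (R : realType) (T : Type) (N : nat) (Z : R -> T -> 'I_N).

Lemma sum_transition_count_from (h : nat -> R) (i : 'I_N) (n : nat) (w : T) :
  (\sum_(k < N) transition_count Z h n i k w
    = \sum_(j < n) (Z (j%:R * h n)%R w == i))%N.
Proof.
rewrite /transition_count exchange_big big_add1 big_mkord /=.
apply: eq_bigr => j _; rewrite -big_distrr (bigD1 (Z (j.+1%:R * h n) w)) //=.
by rewrite eqxx big1 ?addn0 ?muln1 // => l /negPf; rewrite eq_sym => ->.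
Qed.

Lemma sum_transition_count_to (h : nat -> R) (k : 'I_N) (n : nat) (w : T) :
  (\sum_(i < N) transition_count Z h n i k w
    = \sum_(j < n) (Z (j.+1%:R * h n)%R w == k))%N.
Proof.
rewrite /transition_count exchange_big big_add1 big_mkord /=.
apply: eq_bigr => j _; rewrite -big_distrl (bigD1 (Z (j%:R * h n) w)) //=.
by rewrite eqxx big1 ?addn0 ?mul1n // => l /negPf; rewrite eq_sym => ->.
Qed.

Lemma transition_excess_count (h : nat -> R) (c : R) (i k : 'I_N) (n : nat)
    (w : T) :
  transition_excess Z (h n) c i k n w =
  (transition_count Z h n i k w)%:R
  - c * (\sum_(l < N) transition_count Z h n i l w)%:R.
Proof.
rewrite sum_transition_count_from /transition_count big_add1 big_mkord /=.
rewrite !natr_sum mulr_sumr -sumrB; apply: eq_bigr => j _.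
by rewrite natrM; ring.
Qed.

(** Entries into a state and exits from it alternate along a path. *)
Lemma transition_count_balance (h : nat -> R) (i : 'I_N) (n : nat) (w : T) :
  (\sum_(l < N | l != i) transition_count Z h n l i w
    <= (\sum_(l < N | l != i) transition_count Z h n i l w).+1)%N.
Proof.
rewrite -(leq_add2l (transition_count Z h n i i w)) addnS.
have split_i (F : 'I_N -> nat) :
    (F i + \sum_(l < N | l != i) F l = \sum_(l < N) F l)%N.
  by rewrite [RHS](bigD1 i).
rewrite !split_i sum_transition_count_from sum_transition_count_to -addn1.
case: n => [|n]; first by rewrite !big_ord0.
by rewrite big_ord_recr [X in (_ <= X + 1)%N]big_ord_recl
  leq_add ?leq_b1 // leq_addl.
Qed.

Lemma sum_transition_count (h : nat -> R) (n : nat) (w : T) :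
  (\sum_(l < N) \sum_(k < N) transition_count Z h n l k w = n)%N.
Proof.
under eq_bigr do rewrite sum_transition_count_from.
rewrite exchange_big /= -[RHS]card_ord -sum1_card; apply: eq_bigr => j _.
rewrite (bigD1 (Z (j%:R * h n) w)) //= eqxx big1 ?addn0 //.
by move=> l /negPf; rewrite eq_sym => ->.
Qed.

End TransitionCounts.

(** * Pathwise estimates *)

(** The flow into [i] is at least [c * h * (n - r i)] and the flow out of [i]
    at most [N * C * h * r i], up to the compensated counts, and the two flows
    differ by at most 1.  The last hypothesis absorbs this 1 into the error
    [a * (n * h)]. *)
Lemma visits_ge (R : realFieldType) (N : nat) (K : 'I_N -> 'I_N -> nat)
    (p : 'M[R]_N) (h a c C : R) (n : nat) (i : 'I_N) :
  let r l : R := (\sum_(k < N) K l k)%N%:R in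
  (\sum_(l < N) \sum_(k < N) K l k = n)%N ->
  (\sum_(l < N | l != i) K l i <= (\sum_(k < N | k != i) K i k).+1)%N ->
  (forall l k, l != k -> `|(K l k)%:R - p l k * r l| <= a * (n%:R * h)) ->
  (forall l k, l != k -> c * h <= p l k <= C * h) ->
  0 < h -> 0 <= C -> 1 <= a * (n%:R * h) ->
  n%:R * (c - (2 * N%:R + 1) * a) <= (N%:R * C + c) * r i.
Proof.
move=> r Kn flow exc pcC h0 C0 an1.
move xE: (a * (n%:R * h)) exc an1 => x exc an1.
have x0 : 0 <= x by apply: le_trans an1; exact: ler01.
have count_const (y : R) : 0 <= y -> \sum_(l < N | l != i) y <= N%:R * y.
  move=> y0; rewrite sumr_const -[leLHS]mulr_natl ler_wpM2r // ler_nat.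
  by rewrite (leq_trans (max_card _)) ?card_ord.
have r0 l : 0 <= r l by exact: ler0n.
have out : \sum_(k < N | k != i) (K i k)%:R <= N%:R * (C * h * r i + x).
  rewrite (le_trans _ (count_const _ _)) ?addr_ge0 ?mulr_ge0 ?(ltW h0) //.
  apply: ler_sum => k ki; have ik : i != k by rewrite eq_sym.
  have := exc i k ik; have /andP[_ /(ler_wpM2r (r0 i))] := pcC i k ik.
  by rewrite ler_norml => + /andP[_ +]; lra.
have inn : c * h * (n%:R - r i) - N%:R * x <= \sum_(l < N | l != i) (K l i)%:R.
  have -> : n%:R - r i = \sum_(l < N | l != i) r l.
    rewrite -Kn natr_sum (bigD1 i) //=.
    by rewrite -/(r i) addrAC subrr add0r.
  rewrite mulr_sumr lerBlDr (le_trans _ (lerD (lexx _) (count_const x x0))) //.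
  rewrite -big_split /=; apply: ler_sum => l li; have := exc l i li.
  have /andP[+ _] := pcC l i li => /(ler_wpM2r (r0 l)).
  by rewrite ler_norml => + /andP[+ _]; lra.
have fl : \sum_(l < N | l != i) (K l i)%:R
    <= \sum_(k < N | k != i) (K i k)%:R + 1 :> R.
  by rewrite -!natr_sum natr1 ler_nat.
rewrite -(ler_pM2r h0); move: out inn fl an1; rewrite -xE; lra.
Qed.

(** The error of the estimator splits into the compensated count divided by
    [h * r] and the error of the difference quotient [p / h]; each of them is
    at most [eps / 2]. *)
Lemma empirical_rate_close (R : realFieldType) (K r p q h b n eps : R) :
  0 < h -> 0 < b -> 0 < n -> b * n <= r ->
  `|K - p * r| <= b * eps / 2 * (n * h) -> `|p - q * h| <= eps / 2 * h ->
  `|K / (h * r) - q| <= eps.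
Proof.
move=> h0 b0 n0 bnr K1 p1.
have r0 : 0 < r by rewrite (lt_le_trans _ bnr) // mulr_gt0.
have hr0 : 0 < h * r by rewrite mulr_gt0.
have -> : K / (h * r) - q = ((K - p * r) + (p - q * h) * r) / (h * r).
  by field; rewrite !gt_eqF.
rewrite normrM normfV (gtr0_norm hr0) ler_pdivrMr //.
rewrite (le_trans (ler_normD _ _)) // normrM (gtr0_norm r0).
have eps0 : 0 <= eps.
  have := le_trans (normr_ge0 _) p1; rewrite pmulr_lge0 //; lra.
have := ler_wpM2r (ltW r0) p1.
have : eps * h * (b * n) <= eps * h * r by rewrite ler_wpM2l // mulr_ge0 // ltW.
lra.
Qed.

(** * Consistency of the estimator *)

Lemma probability_union_le (R : realType) (d : measure_display)
    (T : measurableType d) (P : probability T R) (I : finType) (D : pred I)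
    (F : I -> set T) (B : R) :
  0 <= B -> (forall x, D x -> measurable (F x)) ->
  (forall x, D x -> fine (P (F x)) <= B) ->
  fine (P (\big[setU/set0]_(x | D x) F x)) <= #|I|%:R * B.
Proof.
move=> B0 mF FB.
apply: (@le_trans _ _ (\sum_(x | D x) B)); last first.
  by rewrite sumr_const -[leLHS]mulr_natl ler_wpM2r // ler_nat max_card.
suff [] : measurable (\big[setU/set0]_(x | D x) F x) /\
   fine (P (\big[setU/set0]_(x | D x) F x)) <= \sum_(x | D x) B by [].
apply: (big_ind2 (fun X y => measurable X /\ fine (P X) <= y)).
- by rewrite measure0.
- move=> X x Y y [mX Xx] [mY Yy]; split; first exact: measurableU.
  apply: le_trans (lerD Xx Yy); rewrite -fineD ?fin_num_measure //.
  rewrite fine_le ?fin_numD ?fin_num_measure ?measureU2 //; exact: measurableU.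
- by move=> x Dx; split; [exact: mF|exact: FB].
Qed.

Lemma generator_increment (R : realType) (N : nat) (p : R -> 'M[R]_N)
    (Q : 'M[R]_N) (h : nat -> R) (eps : R) :
  is_generator p Q -> (forall n, 0 < h n) -> h n @[n --> \oo] --> (0 : R) ->
  0 < eps ->
  \forall n \near \oo, forall l k, l != k ->
    `|p (h n) l k - Q l k * h n| <= eps * h n.
Proof.
move=> [Qp _] h0 hcvg eps0.
apply: filter_forall => l; apply: filter_forall => k.
have /eqaddoP /(_ _ eps0) := Qp l k.
move=> /hcvg near_h; apply: (@filterS _ \oo _ _ _ _ near_h) => n /= close lk.
by have := close (h0 n); rewrite !fctE (negPf lk) add0r (gtr0_norm (h0 n)).
Qed.

Lemma positive_lower_bound (R : realDomainType) (I : finType) (D : pred I)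
    (F : I -> R) :
  (forall x, D x -> 0 < F x) -> exists2 c, 0 < c & forall x, D x -> c <= F x.
Proof.
move=> F0; exists (\big[Num.min/1]_(x | D x) F x).
  by apply: lt_bigmin.
by move=> x Dx; exact: bigmin_le_cond.
Qed.

(** The diagonal entry adds up the errors of the at most [N] off-diagonal
    entries of its row. *)
Lemma qmle_row_close (R : realType) (d : measure_display)
    (T : measurableType d) (P : probability T R) (N : nat)
    (Z : R -> T -> 'I_N) (Q : 'M[R]_N) (h : nat -> R)
    (qhat : nat -> 'I_N -> 'I_N -> {RV P >-> R}) (n : nat) (i k : 'I_N) (w : T)
    (eps : R) :
  is_qmle Z h qhat -> Q i i = - \sum_(j < N | j != i) Q i j -> 0 <= eps ->
  (forall l, l != i -> `|qhat n i l w - Q i l| <= eps) ->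
  `|qhat n i k w - Q i k| <= (N%:R + 1) * eps.
Proof.
move=> [_ qd] Qd eps0 close; have [->|ki] := eqVneq k i; last first.
  by rewrite (le_trans (close k ki)) // ler_peMl // lerDr.
rewrite qd Qd opprK addrC -sumrB (le_trans (ler_norm_sum _ _ _)) //.
apply: (@le_trans _ _ (\sum_(l < N | l != i) eps)).
  by apply: ler_sum => l li; rewrite distrC close.
rewrite sumr_const -[leLHS]mulr_natl ler_wpM2r // ler_wpDr // ler_nat.
by rewrite (leq_trans (max_card _)) ?card_ord.
Qed.

Theorem theorem4p1 (R : realType) (d : measure_display)
    (T : measurableType d) (P : probability T R) (N : nat)
    (Z : R -> T -> 'I_N) (p : R -> 'M[R]_N) (Q : 'M[R]_N)
    (h : nat -> R) (qhat : nat -> 'I_N -> 'I_N -> {RV P >-> R})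
    (Zmarkov : homogeneous_markov_chain P Z p)
    (Qgen : is_generator p Q)
    (Qpos : forall i k : 'I_N, i != k -> 0 < Q i k)
    (Qirr : irreducible_generator Q)
    (pi_unique : exists! nu : 'rV[R]_N, invariant_probability p nu)
    (Zstat : strictly_stationary P Z)
    (h_gt0 : forall n : nat, 0 < h n)
    (h_cvg : h n @[n --> \oo] --> (0 : R))
    (nh_cvg : n%:R * h n @[n --> \oo] --> +oo)
    (nh2_cvg : n%:R * h n ^+ 2 @[n --> \oo] --> (0 : R))
    (Hqhat : is_qmle Z h qhat) :
  forall i k : 'I_N,
    cvg_in_probability (fun n : nat => qhat n i k) (Q i k).
Proof.
move=> i k e e0; have [mZ _ _] := Zmarkov.
(* The factor 2 leaves room for the o(h) term in [p h l m >= c * h]; the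
   summand 1 in [C] plays the same role for the upper bound. *)
have [c c0 cQ] : exists2 c, 0 < c & forall l m, l != m -> 2 * c <= Q l m.
  have [|c c0 cQ] := @positive_lower_bound R ('I_N * 'I_N)%type
      (fun x => x.1 != x.2) (fun x => Q x.1 x.2); first by move=> x /Qpos.
  by exists (c / 2) => [|l m lm]; [lra|have := cQ (l, m) lm => /=; lra].
pose C := \big[Num.max/0]_(x : 'I_N * 'I_N) Q x.1 x.2 + 1.
have CQ l m : Q l m <= C - 1.
  by rewrite addrK (le_bigmax _ (fun x => Q x.1 x.2) (l, m)).
have C0 : 0 <= C by rewrite addr_ge0 // bigmax_ge_id.
have N0 : 0 <= N%:R :> R by [].
pose eps := e / (N%:R + 1).
have eps0 : 0 < eps by rewrite divr_gt0 //; lra.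
(* [b] is the guaranteed proportion of time spent in each state: half of
   [visits_ge]'s bound without error, the other half leaving room for [a]. *)
pose b := c / (2 * (N%:R * C + c)).
have NCc0 : 0 < N%:R * C + c by rewrite ltr_wpDl // mulr_ge0.
have b0 : 0 < b by rewrite divr_gt0 // mulr_gt0.
(* The first term makes the error in [visits_ge] at most [c / 2]; the second
   one is the precision that [empirical_rate_close] asks for. *)
pose a := Num.min (c / (2 * (2 * N%:R + 1))) (b * eps / 2).
have a0 : 0 < a.
  by rewrite lt_min; apply/andP; split; apply: divr_gt0 => //;
    apply: mulr_gt0 => //; lra.
have ac : (2 * N%:R + 1) * a <= c / 2.
  have : a <= c / (2 * (2 * N%:R + 1)) by rewrite ge_min lexx.
  by rewrite ler_pdivlMr; lra.
have ab : a <= b * eps / 2 by rewrite ge_min lexx orbT.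
(* The bounds by [c] and 1 ensure [c * h <= p h <= C * h] off the diagonal. *)
pose eta := Num.min (eps / 2) (Num.min c 1).
have eta0 : 0 < eta by rewrite !lt_min; apply/and3P; split; lra.
have [eta1 eta2 eta3] : [/\ eta <= eps / 2, eta <= c & eta <= 1].
  by split; rewrite !ge_min lexx ?orbT.
pose tail n (x : 'I_N * 'I_N) := [set w |
  a * (n%:R * h n) <
    `|transition_excess Z (h n) (p (h n) x.1 x.2) x.1 x.2 n w|].
(* Chebyshev's inequality summed over all pairs of states. *)
pose bound n := #|{: 'I_N * 'I_N}|%:R * (C / a ^+ 2 * (n%:R * h n)^-1).
have bound_cvg : bound n @[n --> \oo] --> (0 : R).
  rewrite -(mulr0 #|{: 'I_N * 'I_N}|%:R) -(mulr0 (C / a ^+ 2)).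
  apply: cvgMl_tmp; apply: cvgMl_tmp; apply/gtr0_cvgV0 => //.
  by exists 1%N => // n /= n0; rewrite mulr_gt0 // ltr0n.
have mE n : measurable [set w | e < `|qhat n i k w - Q i k|].
  by apply: measurable_norm_gt; apply: measurable_funB.
suff main : \forall n \near \oo,
    fine (P [set w | e < `|qhat n i k w - Q i k|]) <= bound n.
  apply: (@squeeze_cvge _ _ _ _ (cst 0%E) _ (EFin \o bound)).
  - apply: filterS main => n Pn; rewrite measure_ge0 /=.
    by rewrite -[leLHS]fineK ?fin_num_measure // lee_fin.
  - exact: cvg_cst.
  - by apply: cvg_EFin bound_cvg; exact: nearW.
have nh_large : \forall n \near \oo, a^-1 <= n%:R * h n.
  by move/cvgryPge : nh_cvg; apply.
have := generator_increment Qgen h_gt0 h_cvg eta0.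
apply: filterS2 nh_large => n an pQ; set t := n%:R * h n in an.
have t0 : 0 < t by rewrite (lt_le_trans _ an) ?invr_gt0.
have n0 : 0 < n%:R :> R by rewrite -(pmulr_lgt0 _ (h_gt0 n)).
have at1 : 1 <= a * t by rewrite -(divff (lt0r_neq0 a0)) ler_wpM2l // ltW.
have pcC l m : l != m -> c * h n <= p (h n) l m <= C * h n.
  move=> lm; have := pQ l m lm; rewrite ler_norml => /andP[].
  have := ler_wpM2r (ltW (h_gt0 n)) (cQ l m lm).
  have := ler_wpM2r (ltW (h_gt0 n)) (CQ l m).
  have := ler_wpM2r (ltW (h_gt0 n)) eta2.
  have := ler_wpM2r (ltW (h_gt0 n)) eta3.
  by move=> *; apply/andP; split; lra.
have mtail x : measurable (tail n x).
  by apply: measurable_transition_excess_tail => //; exact: ltW.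
have tail_le x : x.1 != x.2 -> fine (P (tail n x)) <= C / a ^+ 2 * t^-1.
  case: x => l m /= lm.
  apply: le_trans (transition_excess_tail _ _ _ Zmarkov _ _) _ => //.
    by rewrite mulr_gt0.
  have /andP[_ pC] := pcC l m lm.
  rewrite (_ : C / a ^+ 2 * t^-1 = n%:R * (C * h n) / (a * t) ^+ 2).
    by rewrite ler_wpM2r ?invr_ge0 ?sqr_ge0 // ler_wpM2l.
  by rewrite /t; field; rewrite !gt_eqF.
apply: (le_trans _ (probability_union_le _ (fun x _ => mtail x) tail_le));
  last first.
  by rewrite mulr_ge0 ?invr_ge0 ?divr_ge0 ?sqr_ge0 // ltW.
rewrite fine_le ?fin_num_measure //; first exact: bigsetU_measurable.
rewrite le_measure ?inE //; first exact: bigsetU_measurable.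
move=> w /=; apply: contraPP => nE; apply/negP; rewrite -leNgt.
(* Outside the tail events the path is good, and the rest is deterministic. *)
have exc l m : l != m -> `|(transition_count Z h n l m w)%:R
    - p (h n) l m * (\sum_(x < N) transition_count Z h n l x w)%:R| <= a * t.
  move=> lm; rewrite -transition_excess_count leNgt.
  apply/negP => tw; apply: nE.
  by rewrite (bigD1 (l, m)) //; left.
rewrite -[leRHS](divfK (x := N%:R + 1)) ?gt_eqF ?ltr_wpDl //.
rewrite [leRHS]mulrC.
apply: (qmle_row_close k Hqhat (Qgen.2 i) (ltW eps0)).
move=> l li; have il : i != l by rewrite eq_sym.
have visits : b * n%:R <= (\sum_(x < N) transition_count Z h n i x w)%:R.
  have := visits_ge (sum_transition_count Z h n w)
    (transition_count_balance Z h i n w) exc pcC (h_gt0 n) C0 at1.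
  have -> : b * n%:R = n%:R * (c / 2) / (N%:R * C + c).
    by rewrite /b; field; rewrite !gt_eqF.
  rewrite ler_pdivrMr // [leRHS]mulrC; apply: le_trans.
  by rewrite ler_wpM2l //; lra.
rewrite (Hqhat.1 n i l w il); last first.
  by apply: contraTneq visits => ->; rewrite -ltNge mulr_gt0.
apply: (empirical_rate_close (p := p (h n) i l) (b := b) (n := n%:R)) => //.
  by apply: le_trans (exc i l il) _; rewrite ler_wpM2r // ltW.
by apply: le_trans (pQ i l il) _; rewrite ler_wpM2r // ltW.
Qed.
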